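(* Let $R$ be a Noetherian Dubrovin valuation ring of a simple Artinian ring $A$, with $P=J(R)$. Then the arithmetical pseudo-valuation $v:\mathcal{F}(R)\to\Gamma$, $v(I)=\{a\in A\mid aI\subseteq P\}$, where $\Gamma=\{v(I)\mid I\in\mathcal{F}(R)\}$, takes values in $\mathbb{Z}$; that is, the totally ordered group $\Gamma$ is isomorphic, as an ordered group, to a subgroup of $\mathbb{Z}$.
   Context: A Dubrovin valuation ring of a simple Artinian ring $A$ is a subring $R$ of $A$ such that $R/J(R)$ is simple Artinian ($J(R)$ the Jacobson radical) and for every $q\in A\setminus R$ there are $r,r'\in R$ with $rq\in R\setminus J(R)$ and $qr'\in R\setminus J(R)$. Such an $R$ is a prime Goldie ring and an order in $A$. Noetherian means left and right Noetherian. A fractional $R$-ideal of $A$ is an $R$-bimodule $I\subseteq A$ which contains a regular element of $R$ and satisfies $rI\subseteq R$ for some regular $r\in R$; $\mathcal{F}(R)$ is the set of fractional $R$-ideals. For a Noetherian Dubrovin valuation ring, $\Gamma$ with the operation $v(I)+v(J)=v(IJ)$ (neutral element $0=v(R)=P$) and the order $v(I)\leq v(J)\Leftrightarrow v(I)\subseteq v(J)$ is a totally ordered group, and $v$ is an arithmetical pseudo-valuation: for all $I,J\in\mathcal{F}(R)$, (1) $v(IJ)=v(I)+v(J)$; (2) $v(I+J)\geq\min\{v(I),v(J)\}$; (3) $v(R)=0$; (4) $I\subseteq J$ implies $v(I)\geq v(J)$. *)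

(* Defs.v *)
From HB Require Import structures.
From mathcomp Require Import all_boot all_order all_algebra.
From mathcomp Require Import boolp classical_sets functions.

Set Implicit Arguments.
Unset Strict Implicit.
Unset Printing Implicit Defensive.

Import Order.TTheory GRing.Theory Num.Theory.

Local Open Scope classical_set_scope.
Local Open Scope ring_scope.

Section RingNotions.
Variable T : nzRingType.
Implicit Types I M N : set T.

Definition additive_subgroup I : Prop :=
  I 0 /\ (forall x y, I x -> I y -> I (x - y)).

Definition left_ideal I : Prop :=
  additive_subgroup I /\ (forall a x, I x -> I (a * x)).

Definition right_ideal I : Prop :=
  additive_subgroup I /\ (forall a x, I x -> I (x * a)).

Definition two_sided_ideal I : Prop := left_ideal I /\ right_ideal I.

Definition ascending_chain_condition (C : set (set T)) : Prop :=
  forall I_ : nat -> set T, (forall n, C (I_ n)) ->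
  (forall n, I_ n `<=` I_ n.+1) ->
  exists m, forall n, (m <= n)%N -> I_ n = I_ m.

Definition descending_chain_condition (C : set (set T)) : Prop :=
  forall I_ : nat -> set T, (forall n, C (I_ n)) ->
  (forall n, I_ n.+1 `<=` I_ n) ->
  exists m, forall n, (m <= n)%N -> I_ n = I_ m.

Definition noetherian : Prop :=
  ascending_chain_condition left_ideal /\ ascending_chain_condition right_ideal.

Definition artinian : Prop :=
  descending_chain_condition left_ideal /\
  descending_chain_condition right_ideal.

(* [1 != 0] is part of [nzRingType]. *)
Definition simple_ring : Prop :=
  forall I, two_sided_ideal I -> I = [set 0] \/ I = setT.

Definition simple_artinian : Prop := simple_ring /\ artinian.

Definition maximal_left_ideal M : Prop :=
  [/\ left_ideal M, M <> setT &
      forall N, left_ideal N -> M `<=` N -> N = M \/ N = setT].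

Definition jacobson_radical : set T := \bigcap_(M in maximal_left_ideal) M.

Definition regular_element (x : T) : Prop := GRing.lreg x /\ GRing.rreg x.

Definition congruent_mod I : rel T := fun x y => x - y \in I.

(* The quotient rings T / I: the ring structures on a quotient of T by
   congruence modulo I for which the projection is a ring morphism. There is
   one, unique up to isomorphism, exactly when I is a proper two-sided ideal. *)
Definition quotient_ring I :=
  nzRingQuotType (congruent_mod I) (0 : T) -%R +%R (1 : T) *%R.

End RingNotions.

Arguments jacobson_radical T : clear implicits.

Section SubringType.
Variables (A : nzRingType) (R : subringClosed A).

Record subring_type : Type := SubringElt {
  subring_val :> A;
  subring_valP : subring_val \in R
}.

HB.instance Definition _ := [isSub for subring_val].
HB.instance Definition _ := [Choice of subring_type by <:].
HB.instance Definition _ := [SubChoice_isSubNzRing of subring_type by <:].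

End SubringType.

Section DubrovinValuation.
Variables (A : nzRingType) (R : subringClosed A).
Implicit Types I J X : set A.

Definition subring_set : set A := [set x | x \in R].

(* J(R), viewed inside A. *)
Definition radical_set : set A :=
  [set val x | x in jacobson_radical (subring_type R)].

Definition dubrovin_valuation_ring : Prop :=
  (exists Q : quotient_ring (jacobson_radical (subring_type R)),
     simple_artinian Q) /\
  (forall q : A, q \notin R ->
     (exists r : subring_type R, (subring_set `\` radical_set) (val r * q)) /\
     (exists r' : subring_type R, (subring_set `\` radical_set) (q * val r'))).

Definition sub_bimodule I : Prop :=
  [/\ additive_subgroup I,
      forall (r : subring_type R) x, I x -> I (val r * x) &
      forall (r : subring_type R) x, I x -> I (x * val r)].

Definition fractional_ideal I : Prop :=
  [/\ sub_bimodule I,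
      exists c : subring_type R, regular_element c /\ I (val c) &
      exists r : subring_type R, regular_element r /\
        forall x, I x -> val r * x \in R].

Definition ideal_mul I J : set A :=
  [set z | exists (n : nat) (x y : 'I_n -> A),
     (forall i, I (x i) /\ J (y i)) /\ z = \sum_i x i * y i].

Definition ideal_add I J : set A := [set x + y | x in I & y in J].

Definition val_of I : set A :=
  [set a | forall x, I x -> radical_set (a * x)].

Definition value_set : set (set A) := [set val_of I | I in fractional_ideal].

End DubrovinValuation.

(* The carrier is the subset G of T; the operation and the order only matter
   on G. *)
Record totally_ordered_group (T : Type) (G : set T) (add : T -> T -> T)
    (zero : T) (le : T -> T -> Prop) : Prop := {
  tog_add_closed : forall x y, G x -> G y -> G (add x y);
  tog_zero_closed : G zero;
  tog_addA : forall x y z, G x -> G y -> G z ->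
    add x (add y z) = add (add x y) z;
  tog_add0 : forall x, G x -> add zero x = x /\ add x zero = x;
  tog_opp : forall x, G x ->
    exists2 y, G y & add y x = zero /\ add x y = zero;
  tog_refl : forall x, G x -> le x x;
  tog_antisym : forall x y, G x -> G y -> le x y -> le y x -> x = y;
  tog_trans : forall x y z, G x -> G y -> G z -> le x y -> le y z -> le x z;
  tog_total : forall x y, G x -> G y -> le x y \/ le y x;
  tog_le_add : forall x y z, G x -> G y -> G z -> le x y ->
    le (add z x) (add z y) /\ le (add x z) (add y z)
}.

Definition min_for (T : Type) (le : T -> T -> Prop) (x y : T) : T :=
  if `[< le x y >] then x else y.

Record arithmetical_pseudo_valuation (A : nzRingType) (R : subringClosed A)
    (T : Type) (G : set T) (add : T -> T -> T) (zero : T)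
    (le : T -> T -> Prop) (w : set A -> T) : Prop := {
  apv_values : forall I, fractional_ideal R I -> G (w I);
  apv_mul : forall I J, fractional_ideal R I -> fractional_ideal R J ->
    fractional_ideal R (ideal_mul I J) /\ w (ideal_mul I J) = add (w I) (w J);
  apv_add : forall I J, fractional_ideal R I -> fractional_ideal R J ->
    fractional_ideal R (ideal_add I J) /\
    le (min_for le (w I) (w J)) (w (ideal_add I J));
  apv_ring : fractional_ideal R (subring_set R) /\ w (subring_set R) = zero;
  apv_anti : forall I J, fractional_ideal R I -> fractional_ideal R J ->
    I `<=` J -> le (w J) (w I)
}.

Definition ordered_isomorphic_to_subgroup_of_int (T : Type) (G : set T)
    (add : T -> T -> T) (le : T -> T -> Prop) : Prop :=
  exists (H : zmodClosed int) (phi : T -> int),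
    [/\ set_bij G [set n | n \in H] phi,
        forall x y, G x -> G y -> phi (add x y) = phi x + phi y &
        forall x y, G x -> G y -> le x y <-> phi x <= phi y].

(* Main.v *)
Require Import Defs.
From mathcomp Require Import all_boot all_order all_algebra.
From mathcomp Require Import boolp classical_sets functions.

Set Implicit Arguments.
Unset Strict Implicit.
Unset Printing Implicit Defensive.

Import Order.TTheory GRing.Theory Num.Theory.

Local Open Scope classical_set_scope.
Local Open Scope ring_scope.

(** If [P] contains no regular element of [R], the only fractional ideal is [R].
    Otherwise let [c] in [P] be regular; it is invertible in [A]. If [A a] met
    [R] only inside [P], then [R c^-n a] would be an ascending chain of left
    ideals of [R], and where it stops [(1 - s c) c^-n a = 0] forces [a = 0].
    Hence each nonzero [a] has a [q] with [q a] in [R] but not in [P], and the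
    chain condition extends this to nonzero right ideals [M] of [R]: some [q]
    maps [M] into [R] but not into [P]. When [M] is two-sided this says that
    [{q | q M <= R} M = R]; together with the mirror statement, [P] is
    invertible, every nonzero ideal of [R] is a power of [P], and the fractional
    ideals are the [P^k] for [k] in [int]. As [v(P^k) = P^(1 - k)], the ordered
    group structure is that of the exponents. *)

(** Otherwise every member of [D] lies strictly below another one, and dependent choice builds a
    chain in [C] that never stops. *)
Lemma acc_maximal (T : nzRingType) (C D : set (set T)) :
    ascending_chain_condition C -> D `<=` C -> D !=set0 ->
  exists2 M, D M & forall N, D N -> M `<=` N -> N `<=` M.
Proof.
move=> acc DC [M0 DM0]; apply: contrapT => noMax.
have next (M : {M | D M}) :
    {N : {M | D M} | sval M `<=` sval N /\ ~ (sval N `<=` sval M)}.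
  apply: cid; apply: contrapT => noN; apply: noMax.
  exists (sval M); first exact: svalP M.
  by move=> N DN MN; apply: contrapT => NM; apply: noN; exists (exist _ N DN).
have [f [_ fS]] := dependent_choice next (exist _ M0 DM0).
have [|n|m fm] := acc (fun n => sval (f n)).
- by move=> n; apply: DC; exact: svalP (f n).
- by have [] := fS n.
by have [_] := fS m; rewrite (fm m.+1) //; apply.
Qed.

(** * One-sided submodules, bimodules and their products *)

Section Submodules.
Variable A : nzRingType.
Implicit Types (R I J K M : set A) (x y : A).

Lemma additive_subgroupN I x : additive_subgroup I -> I x -> I (- x).
Proof. by move=> [I0 IB] Ix; rewrite -sub0r; apply: IB. Qed.

Lemma additive_subgroupD I x y : additive_subgroup I -> I x -> I y -> I (x + y).
Proof.
move=> aI Ix Iy; rewrite -[y]opprK; apply: aI.2 => //.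
exact: additive_subgroupN.
Qed.

Lemma additive_subgroup_sum I n (z : 'I_n -> A) :
  additive_subgroup I -> (forall i, I (z i)) -> I (\sum_i z i).
Proof.
move=> aI Iz; elim/big_ind: _ => // [|x y Ix Iy]; first exact: aI.1.
exact: additive_subgroupD.
Qed.

Definition left_submodule R I :=
  additive_subgroup I /\ forall r x, R r -> I x -> I (r * x).

Definition right_submodule R I :=
  additive_subgroup I /\ forall r x, R r -> I x -> I (x * r).

Definition bimodule R I := left_submodule R I /\ right_submodule R I.

Lemma mem_ideal_mul I J x y : I x -> J y -> ideal_mul I J (x * y).
Proof.
move=> Ix Jy; exists 1%N, (fun=> x), (fun=> y).
by split=> //; rewrite big_ord1.
Qed.

(** Elimination principle for products. [K] is often a preimage, such as the set of [z] with [r * z]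
    in a given submodule, so statements with a fixed factor are covered too. *)
Lemma ideal_mul_sub I J K :
    additive_subgroup K -> (forall x y, I x -> J y -> K (x * y)) ->
  ideal_mul I J `<=` K.
Proof.
move=> aK IJK _ [n [x [y [xy ->]]]]; apply: additive_subgroup_sum => // i.
by have [] := xy i; exact: IJK.
Qed.

Lemma ideal_mul_additive I J :
  additive_subgroup I -> additive_subgroup (ideal_mul I J).
Proof.
move=> aI; split.
  exists 0%N, (fun=> 0), (fun=> 0).
  by split=> [[]//|]; rewrite big_ord0.
move=> _ _ [n [x [y [xy ->]]]] [m [x' [y' [xy' ->]]]].
exists (n + m)%N,
  (fun i : 'I_(n + m) =>
     match fintype.split i with inl j => x j | inr k => - x' k end),
  (fun i : 'I_(n + m) =>
     match fintype.split i with inl j => y j | inr k => y' k end); split.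
  move=> i; case: (fintype.split i) => j; first exact: xy.
  by have [? ?] := xy' j; split=> //; apply: additive_subgroupN.
rewrite big_split_ord /= -sumrN; congr (_ + _); apply: eq_bigr => i _.
  by rewrite (unsplitK (inl i)).
by rewrite (unsplitK (inr i)) mulNr.
Qed.

Lemma ideal_mulS I I' J J' :
  I `<=` I' -> J `<=` J' -> ideal_mul I J `<=` ideal_mul I' J'.
Proof.
move=> II' JJ' z [n [x [y [xy ->]]]]; exists n, x, y; split=> // i.
by have [/II' ? /JJ' ?] := xy i.
Qed.

Lemma ideal_mulA I J K :
    additive_subgroup I -> additive_subgroup J ->
  ideal_mul I (ideal_mul J K) = ideal_mul (ideal_mul I J) K.
Proof.
move=> aI aJ; have aIJ := ideal_mul_additive J aI.
have aIJ_K := ideal_mul_additive K aIJ.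
have aI_JK := ideal_mul_additive (ideal_mul J K) aI.
apply/seteqP; split; apply: ideal_mul_sub => // x y.
  move=> Ix; move: y; apply: ideal_mul_sub => [|y z Jy Kz].
    split=> [|y z]; first by rewrite mulr0; exact: aIJ_K.1.
    by rewrite mulrBr; exact: aIJ_K.2.
  by rewrite mulrA; apply: mem_ideal_mul => //; apply: mem_ideal_mul.
move=> IJx Ky; move: x IJx; apply: ideal_mul_sub => [|x z Ix Jz].
  split=> [|x z]; first by rewrite mul0r; exact: aI_JK.1.
  by rewrite mulrBl; exact: aI_JK.2.
by rewrite -mulrA; apply: mem_ideal_mul => //; apply: mem_ideal_mul.
Qed.

Lemma ideal_mul1l R I : R 1 -> left_submodule R I -> ideal_mul R I = I.
Proof.
move=> R1 [aI RI]; apply/seteqP; split; first exact: ideal_mul_sub.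
by move=> x Ix; rewrite -[x]mul1r; apply: mem_ideal_mul.
Qed.

Lemma ideal_mul1r R I : R 1 -> right_submodule R I -> ideal_mul I R = I.
Proof.
move=> R1 [aI IR]; apply/seteqP; split.
  by apply: ideal_mul_sub => // x y ? ?; apply: IR.
by move=> x Ix; rewrite -[x]mulr1; apply: mem_ideal_mul.
Qed.

Lemma ideal_mul_bimodule R I J :
  bimodule R I -> bimodule R J -> bimodule R (ideal_mul I J).
Proof.
move=> [[aI RI] _] [_ [aJ JR]]; have aIJ := ideal_mul_additive J aI.
split; split=> // r x Rr; move: x; apply: ideal_mul_sub => [|x y Ix Jy].
- split=> [|x y]; first by rewrite mulr0; exact: aIJ.1.
  by rewrite mulrBr; exact: aIJ.2.
- by rewrite mulrA; apply: mem_ideal_mul => //; apply: RI.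
- split=> [|x y]; first by rewrite mul0r; exact: aIJ.1.
  by rewrite mulrBl; exact: aIJ.2.
- by rewrite -mulrA; apply: mem_ideal_mul => //; apply: JR.
Qed.

Lemma ideal_add_absorb I J : additive_subgroup I -> additive_subgroup J ->
  I `<=` J -> ideal_add I J = J.
Proof.
move=> aI aJ IJ; apply/seteqP; split=> [_ [x Ix [y Jy <-]]|y Jy].
  by apply: additive_subgroupD => //; apply: IJ.
by exists 0; [exact: aI.1 | exists y; rewrite ?add0r].
Qed.

Lemma ideal_addC I J : ideal_add I J = ideal_add J I.
Proof.
apply/seteqP; split=> _ [x Ix [y Jy <-]]; exists y => //; exists x => //;
  exact: addrC.
Qed.

End Submodules.

(* What the argument uses of a Noetherian Dubrovin valuation ring [R] with
   radical [P]. These conditions are symmetric, so that each one-sided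
   statement about [A] has a mirror image obtained from the converse ring. *)
Record valuation_pair (A : nzRingType) (R P : set A) : Prop := {
  vp_one : R 1;
  vp_sub : bimodule R R;
  vp_rad : bimodule R P;
  vp_rad_sub : P `<=` R;
  vp_rad1 : ~ P 1;
  vp_rad_unit : forall x, P x -> exists u, u * (1 - x) = 1 /\ (1 - x) * u = 1;
  vp_max : forall I x, bimodule R I -> I x -> R x -> ~ P x -> R `<=` I;
  vp_valuel : forall q, ~ R q -> exists r, [/\ R r, R (r * q) & ~ P (r * q)];
  vp_valuer : forall q, ~ R q -> exists r, [/\ R r, R (q * r) & ~ P (q * r)];
  vp_accl : ascending_chain_condition
    [set I | left_submodule R I /\ I `<=` R];
  vp_accr : ascending_chain_condition
    [set I | right_submodule R I /\ I `<=` R]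
}.

Lemma valuation_pair_converse (A : nzRingType) (R P : set A) :
  valuation_pair R P -> @valuation_pair A^c R P.
Proof.
case=> R1 [RR1 RR2] [RP1 RP2] PR P1 Pu Pmax vl vr al ar.
split=> //; last by move=> I x [? ?]; exact: (Pmax I x).
by move=> x /Pu [u [? ?]]; exists u.
Qed.

(** * Multipliers that carry elements and right ideals into [R] but not into [P] *)

Section Escape.
Variables (A : nzRingType) (R P : set A) (c d : A).
Hypotheses (RP : valuation_pair R P) (Pc : P c) (cd : c * d = 1).

Lemma escape_elt a : a != 0 -> exists q, R (q * a) /\ ~ P (q * a).
Proof.
move=> a_neq0; apply: contrapT => noq.
(* By [vp_valuel] a product outside [R] could be pushed into [R] but not into [P]; so without a
   suitable [q] all of [A a] lies in [P]. *)
have AaP q : P (q * a).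
  have [Rqa|/(vp_valuel RP)[r [Rr Rrqa Prqa]]] := pselect (R (q * a)).
    by apply: contrapT => Pqa; apply: noq; exists q.
  by case: noq; exists (r * q); rewrite -mulrA.
have [[[R0 RB] RM] _] := vp_sub RP.
(* The submodules [R d^n a] lie in [P], and they ascend because [d^n a = c d^(n+1) a]. *)
have [|n x [r Rr <-]|m Im] := vp_accl RP
  (I_ := fun n => [set r * (d ^+ n * a) | r in R]).
- move=> n; split; last by move=> _ [r _ <-]; rewrite mulrA; exact: (vp_rad_sub RP).
  split; first split.
  + by exists 0; rewrite ?mul0r.
  + move=> _ _ [x Rx <-] [y Ry <-].
    by exists (x - y); rewrite ?mulrBl //; apply: RB.
  + move=> r _ Rr [x Rx <-].
    by exists (r * x); rewrite ?mulrA //; apply: RM.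
- exists (r * c); first by apply: RM => //; apply: (vp_rad_sub RP).
  by rewrite exprS !mulrA -(mulrA r) cd mulr1.
have : [set r * (d ^+ m * a) | r in R] (d ^+ m.+1 * a).
  by rewrite -(Im m.+1) //; exists 1; rewrite ?mul1r //; exact: vp_one RP.
move=> [s Rs sE].
have cE n : c * (d ^+ n.+1 * a) = d ^+ n * a by rewrite exprS !mulrA cd mul1r.
have [u [uE _]] : exists u, u * (1 - s * c) = 1 /\ (1 - s * c) * u = 1.
  by apply: (vp_rad_unit RP); apply: (vp_rad RP).1.2.
(* Here [d^(m+1) a = s d^m a = s c d^(m+1) a], and [1 - s c] is invertible because [s c] lies in
   [P]. *)
have b0 : d ^+ m.+1 * a = 0.
  rewrite -[LHS]mul1r -uE -mulrA mulrBl mul1r -(mulrA s) cE sE subrr.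
  by rewrite mulr0.
suff: forall n, d ^+ n * a = 0 -> a = 0 by move/(_ _ b0)/eqP; exact/negP.
elim=> [|n IHn dna]; first by rewrite mul1r.
by apply: IHn; rewrite -cE dna mulr0.
Qed.

(* By the ascending chain condition it suffices to enlarge a submodule [K]
   having such a [q] by one element [b] at a time: either [q] still works or,
   as [q * b] is not in [R], some [r * q] with [r] in [R] does. *)
Lemma escape_submodule M a : right_submodule R M -> M `<=` R -> M a -> a != 0 ->
  exists q, (forall x, M x -> R (q * x)) /\ exists2 x, M x & ~ P (q * x).
Proof.
move=> [aM MR] M_R Ma a_neq0.
have [[[R0 RB] RM] _] := vp_sub RP; have R1 := vp_one RP.
pose good K q := (forall x, K x -> R (q * x)) /\ exists2 x, K x & ~ P (q * x).
pose D := [set K | [/\ right_submodule R K, K `<=` M & exists q, good K q]].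
have [||K [[aK KR] KM [q [qK [x Kx Pqx]]]] Kmax] :=
  acc_maximal (D := D) (vp_accr RP).
- by move=> K [rK KM _]; split=> // x /KM; exact: M_R.
- have [q [Rqa Pqa]] := escape_elt a_neq0.
  exists [set a * r | r in R]; split.
  + split; first split.
    * by exists 0; rewrite ?mulr0.
    * move=> _ _ [x Rx <-] [y Ry <-].
      by exists (x - y); rewrite ?mulrBr //; apply: RB.
    * move=> r _ Rr [x Rx <-].
      by exists (x * r); rewrite ?mulrA //; apply: RM.
  + by move=> _ [r Rr <-]; apply: MR.
  + exists q; split; first by move=> _ [r Rr <-]; rewrite mulrA; apply: RM.
    by exists a => //; exists 1; rewrite ?mulr1.
have [MK|] := pselect (M `<=` K).
  by exists q; split=> [y /MK /qK //|]; exists x => //; apply: KM.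
move=> /existsNP[b /not_implyP[Mb Kb]]; exfalso; apply: Kb.
(* Once [K + b R] is seen to be in [D], maximality of [K] puts [b] in [K]. *)
pose K' := [set y + b * r | y in K & r in R].
have K'E y : K y -> K' y.
  by move=> Ky; exists y => //; exists 0; rewrite ?mulr0 ?addr0.
apply: (Kmax K') => //; last first.
  by exists 0; [exact: aK.1 | exists 1; rewrite ?mulr1 ?add0r].
split.
- split; first split.
  + by apply: K'E; exact: aK.1.
  + move=> _ _ [y Ky [r Rr <-]] [y' Ky' [r' Rr' <-]].
    exists (y - y'); first exact: aK.2.
    by exists (r - r'); [exact: RB | rewrite mulrBr opprD addrACA].
  + move=> s _ Rs [y Ky [r Rr <-]]; exists (y * s); first exact: KR.
    by exists (r * s); [exact: RM | rewrite mulrDl mulrA].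
- move=> _ [y /KM My [r Rr <-]].
  by apply: additive_subgroupD => //; apply: MR.
have goodK' p : R (p * b) -> (forall y, K y -> R (p * y)) ->
    forall y, K' y -> R (p * y).
  move=> Rpb pK _ [y Ky [r Rr <-]]; rewrite mulrDr mulrA.
  apply: additive_subgroupD => //; [exact: pK | exact: RM].
have [Rqb|/(vp_valuel RP)[r [Rr Rrqb Prqb]]] := pselect (R (q * b)).
  by exists q; split; [exact: goodK' | exists x => //; apply: K'E].
exists (r * q); split.
  apply: goodK' => [|y Ky]; first by rewrite -mulrA.
  by rewrite -mulrA; apply: RM => //; apply: qK.
exists b; last by rewrite -mulrA.
by exists 0; [exact: aK.1 | exists 1; rewrite ?mulr1 ?add0r].
Qed.

End Escape.

(** * Integer powers of the radical and the classification of fractional ideals *)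

Section Powers.
Variables (A : nzRingType) (R P : set A) (c d : A).
Hypotheses (RP : valuation_pair R P) (Pc : P c) (cd : c * d = 1) (dc : d * c = 1).
Implicit Types (I J : set A) (n : nat) (k l : int).

Let R1 : R 1 := vp_one RP.
Let bR : bimodule R R := vp_sub RP.
Let bP : bimodule R P := vp_rad RP.

Let mul1I I : bimodule R I -> ideal_mul R I = I.
Proof. by move=> [lI _]; exact: ideal_mul1l. Qed.

Let mulI1 I : bimodule R I -> ideal_mul I R = I.
Proof. by move=> [_ rI]; exact: ideal_mul1r. Qed.

(** This is how a product of bimodules is shown to be all of [R]: one element outside [P] is enough,
    by [vp_max]. *)
Lemma bimodule_full I : bimodule R I -> I `<=` R -> ~ (I `<=` P) -> I = R.
Proof.
move=> bI IR /existsNP[x /not_implyP[Ix Px]]; apply/seteqP; split=> //.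
exact: (vp_max RP bI Ix (IR _ Ix) Px).
Qed.

(** The colon sets of [I] in [R] on the two sides, candidates for its left and right inverse. *)
Definition left_quotient I := [set q : A | forall x, I x -> R (q * x)].
Definition right_quotient I := [set q : A | forall x, I x -> R (x * q)].

Lemma bimodule_left_quotient I : bimodule R I -> bimodule R (left_quotient I).
Proof.
move=> [[aI RI] _]; have [[aR RM] _] := bR.
have aQ : additive_subgroup (left_quotient I).
  split=> [x Ix|q q' Qq Qq' x Ix]; first by rewrite mul0r; exact: aR.1.
  by rewrite mulrBl; apply: aR.2; [exact: Qq | exact: Qq'].
split; split=> // r q Rr Qq x Ix; rewrite -mulrA.
  by apply: RM => //; exact: Qq.
by apply: Qq; exact: RI.
Qed.

Lemma bimodule_right_quotient I : bimodule R I -> bimodule R (right_quotient I).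
Proof.
move=> [_ [aI IR]]; have [_ [aR RM]] := bR.
have aQ : additive_subgroup (right_quotient I).
  split=> [x Ix|q q' Qq Qq' x Ix]; first by rewrite mulr0; exact: aR.1.
  by rewrite mulrBr; apply: aR.2; [exact: Qq | exact: Qq'].
split; split=> // r q Rr Qq x Ix; rewrite mulrA.
  by apply: Qq; exact: IR.
by apply: RM => //; exact: Qq.
Qed.

Lemma left_quotient_mul I a : bimodule R I -> I `<=` R -> I a -> a != 0 ->
  ideal_mul (left_quotient I) I = R.
Proof.
move=> bI IR Ia a0; have bQ := bimodule_left_quotient bI.
have [q [qI [x Ix Pqx]]] := escape_submodule RP Pc cd bI.2 IR Ia a0.
apply: bimodule_full; first exact: ideal_mul_bimodule.
  by apply: ideal_mul_sub => [|p y Qp /Qp //]; exact: bR.1.1.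
by move=> QP; apply: Pqx; apply: QP; apply: mem_ideal_mul.
Qed.

Lemma mul_right_quotient I a : bimodule R I -> I `<=` R -> I a -> a != 0 ->
  ideal_mul I (right_quotient I) = R.
Proof.
move=> bI IR Ia a0; have bQ := bimodule_right_quotient bI.
(* Passing to the converse ring swaps the two inverse equations, so [dc] takes the place of [cd]. *)
have [q [qI [x Ix Pqx]]] :=
  @escape_submodule A^c R P c d (valuation_pair_converse RP) Pc dc I a
    bI.1 IR Ia a0.
apply: bimodule_full; first exact: ideal_mul_bimodule.
  by apply: ideal_mul_sub => [|y p Iy Qp]; [exact: bR.1.1 | exact: Qp].
by move=> QP; apply: Pqx; apply: QP; apply: mem_ideal_mul.
Qed.

Definition rad_inv := left_quotient P.

Let bQ : bimodule R rad_inv := bimodule_left_quotient bP.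

Let c_neq0 : c != 0.
Proof.
apply/eqP => c0; move: cd; rewrite c0 mul0r => /eqP.
by rewrite eq_sym oner_eq0.
Qed.

Lemma rad_invl : ideal_mul rad_inv P = R.
Proof. exact: left_quotient_mul bP (vp_rad_sub RP) Pc c_neq0. Qed.

(** The left inverse [Q] and the right inverse [Q'] of [P] agree, as in a monoid:
    [Q = Q (P Q') = (Q P) Q' = Q']. *)
Lemma rad_invr : ideal_mul P rad_inv = R.
Proof.
have PQ' := mul_right_quotient bP (vp_rad_sub RP) Pc c_neq0.
have bQ' := bimodule_right_quotient bP.
suff -> : rad_inv = right_quotient P by [].
rewrite -(mulI1 bQ) -PQ' ideal_mulA ?rad_invl ?mul1I //; first exact: bQ.1.1.
exact: bP.1.1.
Qed.

(** [Negz n] denotes [-(n + 1)], hence the [n.+1] factors. *)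
Definition rad_pow k : set A :=
  match k with
  | Posz n => iter n (ideal_mul P) R
  | Negz n => iter n.+1 (ideal_mul rad_inv) R
  end.

Lemma bimodule_rad_pow k : bimodule R (rad_pow k).
Proof.
case: k => n; rewrite /rad_pow; [elim: n|elim: n.+1] => //= m IHm;
  exact: ideal_mul_bimodule.
Qed.

Let aP : additive_subgroup P := bP.1.1.
Let aQ : additive_subgroup rad_inv := bQ.1.1.
Let aX k : additive_subgroup (rad_pow k) := (bimodule_rad_pow k).1.1.

Lemma rad_powN n : rad_pow (- n%:Z) = iter n (ideal_mul rad_inv) R.
Proof. by case: n. Qed.

Lemma rad_powS k : rad_pow (k + 1) = ideal_mul P (rad_pow k).
Proof.
case: k => n; first by rewrite -PoszD addn1.
have -> : Negz n + 1 = - n%:Z by rewrite NegzE -addn1 PoszD opprD addrNK.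
rewrite rad_powN /= ideal_mulA // rad_invr mul1I //.
by rewrite -rad_powN; exact: bimodule_rad_pow.
Qed.

Lemma rad_pow_pred k : rad_pow (k - 1) = ideal_mul rad_inv (rad_pow k).
Proof.
rewrite -[in RHS](subrK 1 k) rad_powS ideal_mulA // rad_invl mul1I //.
exact: bimodule_rad_pow.
Qed.

Lemma rad_powD k l : rad_pow (k + l) = ideal_mul (rad_pow k) (rad_pow l).
Proof.
elim: k => [|n IHn|n IHn].
- by rewrite add0r mul1I //; exact: bimodule_rad_pow.
- by rewrite -addn1 PoszD addrAC !rad_powS IHn ideal_mulA.
- by rewrite -addn1 PoszD opprD addrAC !rad_pow_pred IHn ideal_mulA //.
Qed.

Lemma rad_pow_anti k l : l <= k -> rad_pow k `<=` rad_pow l.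
Proof.
rewrite -subr_ge0 => kl; rewrite -(subrK l k).
case: (k - l) kl => // n _; elim: n => [|n IHn]; first by rewrite add0r.
apply: subset_trans IHn.
rewrite -addn1 PoszD addrAC rad_powS.
apply: ideal_mul_sub => [|x y Px Xy]; first exact: aX.
by apply: (bimodule_rad_pow _).1.2 => //; exact: (vp_rad_sub RP).
Qed.

Lemma rad_pow1 : rad_pow 1 = P.
Proof. exact: mulI1. Qed.

(** If [k < l], the inclusion puts [P^k] inside [P^(k+1)]; multiplying by [P^(-k)] puts [R] inside
    [P], against [vp_rad1]. *)
Lemma rad_pow_subset k l : rad_pow k `<=` rad_pow l <-> l <= k.
Proof.
split; last exact: rad_pow_anti.
move=> kl; rewrite leNgt; apply/negP => lt_kl.
have kk : rad_pow k `<=` rad_pow (k + 1).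
  by apply: subset_trans kl _; apply: rad_pow_anti; rewrite lezD1.
have : rad_pow (k - k) `<=` rad_pow (k + 1 - k).
  by rewrite (rad_powD k (- k)) (rad_powD (k + 1)); apply: ideal_mulS.
rewrite addrAC subrr add0r rad_pow1 => /(_ 1 R1); exact: vp_rad1 RP.
Qed.

Lemma rad_pow_inj k l : rad_pow k = rad_pow l -> k = l.
Proof.
by move=> kl; apply/eqP; rewrite eq_le; apply/andP; split;
  apply/rad_pow_subset; rewrite kl.
Qed.

(** If [I] lies in every [P^n], the chain condition on the ideals [P^(-n) I] of [R] gives a
    contradiction. Otherwise there is a last [n] with [I] inside [P^n], and [P^(-n) I] is an ideal
    of [R] not inside [P], that is, [R]. *)
Lemma bimodule_rad_powP I a : bimodule R I -> I a -> a != 0 -> I `<=` R ->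
  exists k, I = rad_pow k.
Proof.
move=> bI Ia a0 IR; have aI := bI.1.1.
have bJ k : bimodule R (ideal_mul (rad_pow k) I).
  by apply: ideal_mul_bimodule => //; exact: bimodule_rad_pow.
have IJ k : I = ideal_mul (rad_pow k) (ideal_mul (rad_pow (- k)) I).
  by rewrite ideal_mulA // -rad_powD subrr mul1I.
have JR k : I `<=` rad_pow k -> ideal_mul (rad_pow (- k)) I `<=` R.
  move=> Ik; rewrite -[R]/(rad_pow 0) -(subrr k) addrC rad_powD.
  exact: ideal_mulS.
have [allI|] := pselect (forall n, I `<=` rad_pow n%:Z).
  pose J n := ideal_mul (rad_pow (- n%:Z)) I.
  have JS n : J n.+1 = ideal_mul rad_inv (J n).
    by rewrite /J -addn1 PoszD opprD rad_pow_pred -ideal_mulA.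
  have [|n|m Jm] := vp_accl RP (I_ := J).
  - by move=> n; split; [exact: (bJ _).1 | exact: JR].
  - by apply: ideal_mulS => //; apply: rad_pow_anti; rewrite lerN2 lez_nat.
  have Jma : J m a.
    rewrite -[a]mul1r; apply: mem_ideal_mul => //.
    by apply: (@rad_pow_anti 0) => //; rewrite oppr_le0.
  (* [J m] is cancelled on the right in [J m = J m.+1 = rad_inv J m]. This leaves [rad_inv = R], so
     the exponents [-1] and [0] would give the same power. *)
  have JJ := mul_right_quotient (bJ _) (JR _ (allI m)) Jma a0.
  have QR : rad_inv = R.
    transitivity (ideal_mul (J m.+1) (right_quotient (J m))); last by rewrite Jm.
    by rewrite JS -ideal_mulA ?JJ ?mulI1 //; exact: (bJ _).1.1.
  by have /rad_pow_inj : rad_pow (-1) = rad_pow 0 by rewrite -[RHS]QR; exact: mulI1.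
move=> /existsNP noI.
have [n In nmin] : exists2 n, ~ (I `<=` rad_pow n%:Z) &
    forall m, (m < n)%N -> I `<=` rad_pow m%:Z.
  have exI : exists n, `[< ~ (I `<=` rad_pow n%:Z) >].
    by have [n nI] := noI; exists n; apply/asboolP.
  case: (ex_minnP exI) => n /asboolP In nmin; exists n => // m mn.
  by apply: contrapT => /asboolP /nmin; rewrite leqNgt mn.
(* The first failing exponent is not [0], since [I] lies in [R]; its predecessor is the exponent
   sought. *)
case: n In nmin => [/(_ IR) []|n In nmin]; exists n%:Z.
rewrite {1}(IJ n) (_ : ideal_mul (rad_pow (- n%:Z)) I = R).
  by rewrite mulI1 //; exact: bimodule_rad_pow.
apply: bimodule_full; [exact: bJ | by apply: JR; exact: nmin|].
move=> JP; apply: In; rewrite (IJ n) -addn1 PoszD rad_powD rad_pow1.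
exact: ideal_mulS.
Qed.

Lemma rad_pow_unit_power n : rad_pow n%:Z (c ^+ n).
Proof.
elim: n => [|n IHn]; first exact: R1.
by rewrite exprS; apply: mem_ideal_mul.
Qed.

(* [R r R] is an ideal of [R], hence a power of [P], and it maps [I] into [R]. *)
Lemma fractional_rad_pow I a r : bimodule R I -> I a -> a != 0 -> R r ->
    r != 0 -> (forall x, I x -> R (r * x)) ->
  exists k, I = rad_pow k.
Proof.
move=> bI Ia a0 Rr r0 rI; have [aI IR] := bI.2; have [aR RM] := bR.1.
pose K := ideal_mul [set s * r | s in R] R.
have aK0 : additive_subgroup [set s * r | s in R].
  split; first by exists 0; rewrite ?mul0r //; exact: aR.1.
  move=> _ _ [x Rx <-] [y Ry <-].
  by exists (x - y); rewrite ?mulrBl //; apply: aR.2.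
have aK := ideal_mul_additive R aK0.
have bK : bimodule R K.
  have [[_ lK] _] : bimodule R R := bR.
  split; split=> // s x Rs; move: x; apply: ideal_mul_sub.
  - split=> [|x y]; first by rewrite mulr0; exact: aK.1.
    by rewrite mulrBr; exact: aK.2.
  - move=> _ y [t Rt <-] Ry; rewrite mulrA; apply: mem_ideal_mul => //.
    by exists (s * t); rewrite ?mulrA //; apply: RM.
  - split=> [|x y]; first by rewrite mul0r; exact: aK.1.
    by rewrite mulrBl; exact: aK.2.
  - move=> x y Kx Ry; rewrite -mulrA; apply: mem_ideal_mul => //.
    exact: RM.
have [k Kk] : exists k, K = rad_pow k.
  apply: (@bimodule_rad_powP _ r) => //.
    by rewrite -[r]mulr1; apply: mem_ideal_mul => //; exists 1; rewrite ?mul1r.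
  by apply: ideal_mul_sub => // _ y [s Rs <-] Ry; apply: (RM) => //; apply: RM.
have KI : ideal_mul K I `<=` R.
  apply: ideal_mul_sub => // x y Kx Iy; move: x Kx; apply: ideal_mul_sub.
    split=> [|x z]; first by rewrite mul0r; exact: aR.1.
    by rewrite mulrBl; exact: aR.2.
  move=> _ z [s Rs <-] Rz; rewrite -!mulrA; apply: RM => //.
  by apply: rI; apply: bI.1.2.
(* As [K] is the invertible [P^k], [I] is recovered from [K I], an ideal of [R] to which the
   classification applies again. *)
have IK : I = ideal_mul (rad_pow (- k)) (ideal_mul K I).
  by rewrite Kk ideal_mulA // -rad_powD addNr mul1I.
have [l KIl] : exists l, ideal_mul K I = rad_pow l.
  have [x KIx x0] : exists2 x, ideal_mul K I x & x != 0.
    apply: contrapT => KI0; case/eqP: a0.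
    have: [set 0] a; last by [].
    move: Ia; rewrite IK; move: a; apply: ideal_mul_sub => [|x y _ KIy].
      by split=> // _ _ -> ->; rewrite subrr.
    case: (eqVneq y 0) => [->|y0]; first by rewrite mulr0.
    by case: KI0; exists y.
  by apply: (@bimodule_rad_powP _ x) => //; apply: ideal_mul_bimodule.
by exists (- k + l); rewrite {1}IK KIl rad_powD.
Qed.

(** The left side is the value of [P^k]. If [a P^k] lies in [P], then [a] lies in [a P^k P^(-k)],
    hence in [P P^(-k)]. *)
Lemma rad_pow_colon k :
  [set a | forall x, rad_pow k x -> P (a * x)] = rad_pow (1 - k).
Proof.
apply/seteqP; split=> [a aP'|a Xa x Xx]; last first.
  by rewrite -rad_pow1 -(subrK k 1) rad_powD; apply: mem_ideal_mul.
have X1 : rad_pow (k - k) 1 by rewrite subrr.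
(* [1] is generalized to any element of [P^k P^(-k)], so that only products remain to be treated. *)
rewrite -[a]mulr1; move: (1 : A) X1; rewrite rad_powD; apply: ideal_mul_sub.
  split=> [|x y]; first by rewrite mulr0; exact: (aX _).1.
  by rewrite mulrBr; exact: (aX _).2.
move=> x y Xx Xy; rewrite mulrA rad_powD rad_pow1.
by apply: mem_ideal_mul => //; exact: aP'.
Qed.

End Powers.

(** * The Jacobson radical and its quotient ring *)

(** Without a left inverse of [1 - y], the left ideal it generates would lie in a maximal one, which
    also contains [y], hence [1]. The left inverse [u] of [1 - x] is [1 + u x], again of this form,
    so it has a left inverse too and is two-sided. *)
Lemma radical_unit (T : nzRingType) (x : T) :
    ascending_chain_condition (@left_ideal T) -> jacobson_radical T x ->
  exists u, u * (1 - x) = 1 /\ (1 - x) * u = 1.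
Proof.
move=> acc.
have leftinv y : jacobson_radical T y -> exists u, u * (1 - y) = 1.
  move=> Jy; apply: contrapT => noinv.
  pose I := [set u * (1 - y) | u in setT].
  have lI : left_ideal I.
    split; first split.
    - by exists 0; rewrite ?mul0r.
    - by move=> _ _ [u _ <-] [v _ <-]; exists (u - v); rewrite ?mulrBl.
    - by move=> a _ [u _ <-]; exists (a * u); rewrite ?mulrA.
  have [||M [lM IM M1] Mmax] :=
    @acc_maximal _ _ [set N | [/\ left_ideal N, I `<=` N & ~ N 1]] acc.
  - by move=> N [].
  - by exists I; split=> // -[u _ u1]; apply: noinv; exists u.
  have maxM : maximal_left_ideal M.
    split=> // [MT|N lN MN]; first by apply: M1; rewrite MT.
    have [N1|N1] := pselect (N 1); [right|left]; apply/seteqP; split=> //.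
      by move=> z _; rewrite -[z]mulr1; exact: lN.2.
    by apply: Mmax => //; split=> //; exact: subset_trans MN.
  apply: M1; rewrite -(subrK y 1); apply: additive_subgroupD; first exact: lM.1.
    by apply: IM; exists 1; rewrite ?mul1r.
  exact: Jy.
move=> Jx; have [u ux] := leftinv x Jx.
have Jux : jacobson_radical T (- (u * x)).
  move=> M maxM; have [[aM lM] _ _] := maxM.
  by apply: additive_subgroupN => //; apply: lM; exact: Jx.
have [v] := leftinv _ Jux.
have -> : 1 - - (u * x) = u by rewrite opprK -[X in X + _]ux mulrBr mulr1 subrK.
move=> vu; have vx : v = 1 - x by rewrite -[v]mulr1 -[in LHS]ux mulrA vu mul1r.
by exists u; rewrite ux -vx.
Qed.

Section RadicalQuotient.
Variables (T : nzRingType) (Q : quotient_ring (jacobson_radical T)).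
Local Notation J := (jacobson_radical T).
Local Notation pi := (\pi_Q%qT : T -> Q).

(** The radical is the kernel of the projection; this yields closure under right multiplication,
    which an intersection of maximal left ideals does not show directly. *)
Lemma radicalE x : J x <-> pi x = 0.
Proof.
rewrite -(rmorph0 pi); split=> [Jx|/eqquotP].
  by apply/eqquotP; rewrite /congruent_mod subr0 in_setE.
by rewrite /congruent_mod subr0 in_setE.
Qed.

Lemma radical_two_sided : two_sided_ideal J.
Proof.
have aJ : additive_subgroup J.
  split; first by apply/radicalE; rewrite rmorph0.
  move=> x y /radicalE x0 /radicalE y0; apply/radicalE.
  by rewrite rmorphB /= x0 y0 subr0.
split; split=> // a x /radicalE x0; apply/radicalE.
  by rewrite rmorphM /= x0 mulr0.
by rewrite rmorphM /= x0 mul0r.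
Qed.

Lemma radical1 : ~ J 1.
Proof. by move/radicalE; rewrite rmorph1 => /eqP; rewrite oner_eq0. Qed.

(** The image of [I] in the simple ring [Q] is nonzero, so some [i] in [I] maps to [1]; then [1 - i]
    is in the radical, which makes [i] a unit. *)
Lemma radical_maximal I x : ascending_chain_condition (@left_ideal T) ->
  simple_ring Q -> two_sided_ideal I -> I x -> ~ J x -> I = setT.
Proof.
move=> acc simpleQ [[aI lI] [_ rI]] Ix Jx.
have sI : two_sided_ideal [set pi y | y in I].
  have aK : additive_subgroup [set pi y | y in I].
    split; first by exists 0; [exact: aI.1 | exact: rmorph0].
    move=> _ _ [y Iy <-] [z Iz <-].
    by exists (y - z); [exact: aI.2 | exact: rmorphB].
  split; split=> // a _ [y Iy <-]; rewrite -[a]reprK.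
    by exists (repr a * y); [exact: lI | exact: rmorphM].
  by exists (y * repr a); [exact: rI | exact: rmorphM].
have [I0|IT] := simpleQ _ sI.
  exfalso; apply/Jx/radicalE.
  have : [set pi y | y in I] (pi x) by exists x.
  by rewrite I0.
have [i Ii i1] : [set pi y | y in I] 1 by rewrite IT.
have [|u [uE _]] := @radical_unit T (1 - i) acc.
  by apply/radicalE; rewrite rmorphB /= rmorph1 i1 subrr.
apply/seteqP; split=> // y _.
rewrite -[y]mulr1 -uE opprB addrC subrK.
by apply: (lI); apply: lI.
Qed.

End RadicalQuotient.

(** * Passage from the subring type to subsets of [A] *)

Section SubringTransfer.
Variables (A : nzRingType) (R : subringClosed A).
Local Notation T := (subring_type R).

Lemma radical_setE (x : T) : radical_set R (val x) <-> jacobson_radical T x.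
Proof. by split=> [[y Jy /val_inj <-]|Jx] //; exists x. Qed.

Lemma sub_bimoduleE I : sub_bimodule R I <-> bimodule (subring_set R) I.
Proof.
split=> [[aI lI rI]|[[aI lI] [_ rI]]].
  split; split=> // r x Rr; first exact: (lI (SubringElt Rr)).
  exact: (rI (SubringElt Rr)).
by split=> // r x Ix; [apply: lI | apply: rI] => //; exact: valP.
Qed.

Lemma preimage_val_eq (I J : set A) : I `<=` subring_set R ->
  J `<=` subring_set R -> val @^-1` I = val @^-1` J :> set T -> I = J.
Proof.
move=> IR JR IJ; apply/seteqP; split=> x.
  move=> Ix; have := Ix; rewrite -[x]/(val (SubringElt (IR _ Ix))).
  by rewrite -[I _]/((val @^-1` I) _) IJ.
move=> Jx; have := Jx; rewrite -[x]/(val (SubringElt (JR _ Jx))).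
by rewrite -[J _]/((val @^-1` J) _) -IJ.
Qed.

Lemma preimage_val_additive I :
  additive_subgroup I -> additive_subgroup (val @^-1` I : set T).
Proof.
move=> aI; split; first by rewrite /preimage /mkset rmorph0; exact: aI.1.
by move=> x y Ix Iy; rewrite /preimage /mkset rmorphB; exact: aI.2.
Qed.

Lemma preimage_val_left_ideal I :
  left_submodule (subring_set R) I -> left_ideal (val @^-1` I : set T).
Proof.
move=> [aI lI]; split; first exact: preimage_val_additive.
by move=> a x Ix; rewrite /preimage /mkset rmorphM; apply: lI => //; exact: valP.
Qed.

Lemma preimage_val_right_ideal I :
  right_submodule (subring_set R) I -> right_ideal (val @^-1` I : set T).
Proof.
move=> [aI rI]; split; first exact: preimage_val_additive.
by move=> a x Ix; rewrite /preimage /mkset rmorphM; apply: rI => //; exact: valP.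
Qed.

Lemma ascending_chain_condition_transfer (C : set (set A)) (D : set (set T)) :
    (forall I, C I -> I `<=` subring_set R /\ D (val @^-1` I)) ->
  ascending_chain_condition D -> ascending_chain_condition C.
Proof.
move=> CD acc I_ CI I_S.
have [|n x|m Im] := acc (fun n => val @^-1` I_ n : set T).
- by move=> n; have [] := CD _ (CI n).
- exact: I_S.
by exists m => n mn; apply: preimage_val_eq (Im n mn); apply: (CD _ _).1.
Qed.

Lemma dubrovin_valuation_pair :
    dubrovin_valuation_ring R -> noetherian (subring_type R) ->
  valuation_pair (subring_set R) (radical_set R).
Proof.
move=> [[Q [simpleQ _]] valu] [accl accr].
have aR : additive_subgroup (subring_set R).
  by split=> [|x y ? ?]; [exact: rpred0 | exact: rpredB].
have [[aJ lJ] [_ rJ]] := radical_two_sided Q.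
have PR : radical_set R `<=` subring_set R by move=> _ [x _ <-]; exact: valP.
have aP : additive_subgroup (radical_set R).
  split; first by exists 0; [exact: aJ.1 | rewrite rmorph0].
  move=> _ _ [x Jx <-] [y Jy <-].
  by exists (x - y); [exact: aJ.2 | rewrite rmorphB].
split=> //.
- exact: rpred1.
- by split; split=> // r x ? ?; exact: rpredM.
- split; split=> // r _ Rr [x Jx <-].
    by exists (SubringElt Rr * x); [exact: lJ | rewrite rmorphM].
  by exists (x * SubringElt Rr); [exact: rJ | rewrite rmorphM].
- by rewrite -(rmorph1 (val : T -> A)) radical_setE; exact: radical1 Q.
- move=> _ [x Jx <-]; have [u [ux xu]] := radical_unit accl Jx.
  by exists (val u); rewrite -(rmorph1 (val : T -> A)) -rmorphB -!rmorphM ux xu.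
- move=> I x [lI rI] Ix Rx Px y Ry.
  have IT := @radical_maximal _ Q (val @^-1` I) (SubringElt Rx) accl simpleQ.
  rewrite -[y]/(val (SubringElt Ry)) -[I _]/((val @^-1` I) _) IT //.
    by split; [exact: preimage_val_left_ideal | exact: preimage_val_right_ideal].
  by rewrite -radical_setE.
- by move=> q /negP/valu [[r [? ?]] _]; exists (val r); split=> //; exact: valP.
- by move=> q /negP/valu [_ [r [? ?]]]; exists (val r); split=> //; exact: valP.
- apply: ascending_chain_condition_transfer accl => I [lI IR].
  by split=> //; exact: preimage_val_left_ideal.
- apply: ascending_chain_condition_transfer accr => I [rI IR].
  by split=> //; exact: preimage_val_right_ideal.
Qed.

End SubringTransfer.

(** * Inverses of regular elements *)

(** Right cancellation of [c] extends to [A], since [vp_valuel] brings elements back into [R]. The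
    chain [A c^n] stops, so [d c^(m+1) = c^m] for some [d]; cancelling gives [d c = 1], and
    [(c d - 1) c = 0] gives the other equation. *)
Lemma regular_invertible (A : nzRingType) (R P : set A) (c : A) :
    valuation_pair R P -> descending_chain_condition (@left_ideal A) ->
    (forall x, R x -> x * c = 0 -> x = 0) ->
  exists d, c * d = 1 /\ d * c = 1.
Proof.
move=> RP dcc cregr; have P0 := (vp_rad RP).1.1.1.
have rreg x : x * c = 0 -> x = 0.
  move=> xc; apply: contrapT => x0; have [Rx|Rx] := pselect (R x).
    by apply: x0; exact: cregr.
  have [r [_ Rrx]] := vp_valuel RP Rx; apply.
  by rewrite (cregr (r * x)) // -mulrA xc mulr0.
have [|n x [a _ <-]|m Im] := dcc (fun n => [set a * c ^+ n | a in setT]).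
- move=> n; split; first split.
  + by exists 0; rewrite ?mul0r.
  + by move=> _ _ [a _ <-] [b _ <-]; exists (a - b); rewrite ?mulrBl.
  + by move=> a _ [b _ <-]; exists (a * b); rewrite ?mulrA.
- by exists (a * c); rewrite // exprS mulrA.
have [d _ dE] : [set a * c ^+ m.+1 | a in setT] (c ^+ m).
  by rewrite Im //; exists 1; rewrite ?mul1r.
have cm n x : x * c ^+ n = 0 -> x = 0.
  by elim: n => [|n IHn]; rewrite ?mulr1 // exprSr mulrA => /rreg.
have dc : d * c = 1.
  by apply/subr0_eq/(cm m); rewrite mulrBl mul1r -mulrA -exprS dE subrr.
exists d; split=> //; apply/subr0_eq/rreg.
by rewrite mulrBl -mulrA dc mulr1 mul1r subrr.
Qed.

(** * The ordered group of values, indexed by a subgroup [H] of the integers *)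

Section ValueGroup.
Variables (A : nzRingType) (R : subringClosed A) (H : zmodClosed int).
Variable X : int -> set A.
Hypotheses
  (fracE : forall I, fractional_ideal R I <-> exists2 k, k \in H & I = X k)
  (X0 : X 0 = subring_set R)
  (X_sub : forall k l, k \in H -> l \in H -> X k `<=` X l <-> l <= k)
  (XD : forall k l, k \in H -> l \in H -> ideal_mul (X k) (X l) = X (k + l))
  (val_sub : forall k l, k \in H -> l \in H ->
    val_of R (X k) `<=` val_of R (X l) <-> k <= l)
  (val0 : val_of R (X 0) = radical_set R).

Local Notation V k := (val_of R (X k)).

(** The default [0] only concerns sets that are not values; for a value the exponent is unique by
    [val_sub]. *)
Definition exponent (S : set A) : int := xget 0 [set k | k \in H /\ S = V k].

(** Addition is transported from the exponents; [XD] makes it agree with multiplication of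
    fractional ideals. *)
Definition value_add (S T : set A) : set A := V (exponent S + exponent T).

Let H0 : 0 \in H := rpred0 H.

Lemma exponentK k : k \in H -> exponent (V k) = k.
Proof.
move=> Hk; apply: xget_unique => // l [Hl VE].
by apply/eqP; rewrite eq_le; apply/andP; split; apply/val_sub => //; rewrite VE.
Qed.

Lemma value_setP S : value_set R S <-> exists2 k, k \in H & S = V k.
Proof.
split=> [[I /fracE[k Hk ->] <-]|[k Hk ->]]; first by exists k.
by exists (X k) => //; apply/fracE; exists k.
Qed.

Lemma value_addE k l : k \in H -> l \in H -> value_add (V k) (V l) = V (k + l).
Proof. by move=> Hk Hl; rewrite /value_add !exponentK. Qed.

Lemma value_group :
  totally_ordered_group (value_set R) value_add (radical_set R) subset.
Proof.
rewrite -val0.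
split=> [S T|||S|S|S|S T|S T U|S T|S T U].
- move=> /value_setP[k Hk ->] /value_setP[l Hl ->]; rewrite value_addE //.
  by apply/value_setP; exists (k + l) => //; exact: rpredD.
- by apply/value_setP; exists 0.
- move=> S T U /value_setP[k Hk ->] /value_setP[l Hl ->] /value_setP[m Hm ->].
  by rewrite !value_addE ?rpredD // addrA.
- by move=> /value_setP[k Hk ->]; rewrite !value_addE // add0r addr0.
- move=> /value_setP[k Hk ->]; exists (V (- k)).
    by apply/value_setP; exists (- k); rewrite ?rpredN.
  by rewrite !value_addE ?rpredN // addNr subrr.
- by move=> _ x.
- by move=> _ _ ST TS; apply/seteqP.
- by move=> _ _ _; exact: subset_trans.
- move=> /value_setP[k Hk ->] /value_setP[l Hl ->].
  by have [kl|/ltW lk] := leP k l; [left|right]; apply/val_sub.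
- move=> /value_setP[k Hk ->] /value_setP[l Hl ->] /value_setP[m Hm ->].
  move=> /val_sub -/(_ Hk Hl) kl; rewrite !value_addE //; split;
    by apply/val_sub; rewrite ?rpredD // ?lerD2l ?lerD2r.
Qed.

(** Fractional ideals form a chain, so a sum of two is the larger one; its exponent, and hence its
    value, is the smaller of the two. *)
Lemma value_pseudo_valuation :
  arithmetical_pseudo_valuation R (value_set R) value_add (radical_set R)
    subset (val_of R).
Proof.
have fracX k : k \in H -> fractional_ideal R (X k).
  by move=> Hk; apply/fracE; exists k.
have aX k : k \in H -> additive_subgroup (X k) by case/fracX=> [[]].
split.
- by move=> I fI; exists I.
- move=> _ _ /fracE[k Hk ->] /fracE[l Hl ->]; rewrite XD //.
  by split; [apply: fracX; rewrite rpredD | rewrite value_addE].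
- move=> _ _ /fracE[k Hk ->] /fracE[l Hl ->].
  have [kl|/ltW lk] := leP k l.
    rewrite ideal_addC (ideal_add_absorb (aX l Hl) (aX k Hk)); last by apply/X_sub.
    split; first exact: fracX.
    by rewrite /min_for asboolT //; apply/val_sub.
  rewrite (ideal_add_absorb (aX k Hk) (aX l Hl)); last by apply/X_sub.
  (* The minimum is [V l] unless [V k] lies in [V l]; either way it lies in [V l]. *)
  by split; [exact: fracX | rewrite /min_for; case: asboolP => // _ x].
- by rewrite -X0 -val0; split=> //; exact: fracX.
- move=> _ _ /fracE[k Hk ->] /fracE[l Hl ->] lk.
  by apply/val_sub => //; apply/X_sub.
Qed.

Lemma value_group_int :
  ordered_isomorphic_to_subgroup_of_int (value_set R) value_add subset.
Proof.
exists H, exponent; split.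
- split.
  + by move=> _ /value_setP[k Hk ->]; rewrite /mkset exponentK.
  + move=> S T; rewrite !inE => /value_setP[k Hk ->] /value_setP[l Hl ->].
    by rewrite !exponentK // => ->.
  + move=> k Hk; exists (V k); last exact: exponentK.
    by apply/value_setP; exists k.
- move=> _ _ /value_setP[k Hk ->] /value_setP[l Hl ->].
  by rewrite value_addE // !exponentK ?rpredD.
- move=> _ _ /value_setP[k Hk ->] /value_setP[l Hl ->].
  by rewrite !exponentK //; exact: val_sub.
Qed.

End ValueGroup.

(** * Fractional ideals of [R], with and without a regular element in the radical *)

Lemma val_of_subring (A : nzRingType) (R : subringClosed A) :
    valuation_pair (subring_set R) (radical_set R) ->
  val_of R (subring_set R) = radical_set R.
Proof.
move=> RP; apply/seteqP; split=> [a /(_ 1 (vp_one RP))|a Pa x Rx].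
  by rewrite mulr1.
exact: (vp_rad RP).2.2.
Qed.

(** [I] and its left colon [K] each contain a regular element of [R], hence one outside the radical,
    so [vp_max] puts [R] in both; [1] in [K] means that [I] lies in [R]. *)
Lemma fractional_ideal_trivial (A : nzRingType) (R : subringClosed A) I :
    valuation_pair (subring_set R) (radical_set R) ->
    (forall c : subring_type R, regular_element c -> ~ radical_set R (val c)) ->
  fractional_ideal R I -> I = subring_set R.
Proof.
move=> RP noreg [/sub_bimoduleE bI [c [creg Ic]] [r [rreg rI]]].
have [[aR lR] [_ rR]] := vp_sub RP.
pose K := [set x | forall y, I y -> subring_set R (x * y)].
have bK : bimodule (subring_set R) K.
  have aK : additive_subgroup K.
    split=> [y Iy|x x' Kx Kx' y Iy]; first by rewrite mul0r; exact: aR.1.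
    by rewrite mulrBl; apply: aR.2; [exact: Kx | exact: Kx'].
  split; split=> // s x Rs Kx y Iy; rewrite -mulrA.
    by apply: lR => //; exact: Kx.
  by apply: Kx; apply: bI.1.2.
have K1 : K 1.
  by apply: (vp_max RP bK rI (valP r) (noreg r rreg)); exact: vp_one RP.
apply/seteqP; split=> [x Ix|]; first by rewrite -[x]mul1r; exact: K1.
exact: (vp_max RP bI Ic (valP c) (noreg c creg)).
Qed.

Lemma regular_element_val_invertible (A : nzRingType) (R : subringClosed A)
    (c : subring_type R) :
    valuation_pair (subring_set R) (radical_set R) ->
    descending_chain_condition (@left_ideal A) -> regular_element c ->
  exists d, val c * d = 1 /\ d * val c = 1.
Proof.
move=> RP dcc [_ creg]; apply: (regular_invertible RP dcc) => x Rx xc.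
suff: SubringElt Rx = 0 by move/(congr1 val); rewrite rmorph0.
by apply: creg; apply: val_inj; rewrite !rmorphM rmorph0 mul0r.
Qed.

(** [dvdz 1] encodes the whole group of integers. For the converse, [c^|k|] witnesses both
    conditions on [P^k]: it lies in [P^|k|], hence in [P^k], and it maps [P^k] into [P^(|k|+k)],
    inside [R]. *)
Lemma fractional_ideal_rad_pow (A : nzRingType) (R : subringClosed A)
    (c : subring_type R) (d : A) I :
    valuation_pair (subring_set R) (radical_set R) ->
    regular_element c -> radical_set R (val c) ->
    val c * d = 1 -> d * val c = 1 ->
  fractional_ideal R I <->
    exists2 k, k \in GRing.ZmodClosed.clone int (dvdz 1) _ &
      I = rad_pow (subring_set R) (radical_set R) k.
Proof.
move=> RP creg Pc cd dc.
have valX n : val (c ^+ n) = val c ^+ n by rewrite rmorphXn.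
split=> [[/sub_bimoduleE bI [a [areg Ia]] [r [rreg rI]]]|[k _ ->]].
  have val_neq0 (x : subring_type R) : regular_element x -> val x != 0.
    move=> [xreg _]; apply/eqP => x0; have /eqP := lreg_neq0 xreg; apply.
    by apply: val_inj; rewrite rmorph0.
  have [k ->] := fractional_rad_pow RP Pc cd dc bI Ia (val_neq0 a areg)
    (valP r) (val_neq0 r rreg) rI.
  by exists k; rewrite // dvd1z.
have regX n : regular_element (c ^+ n).
  by case: creg => ? ?; split; [exact: lregX | exact: rregX].
split.
- by apply/sub_bimoduleE; exact: (bimodule_rad_pow RP).
- exists (c ^+ `|k|); split; rewrite ?valX //.
  apply: (rad_pow_anti RP Pc cd dc (k := `|k|%N)); first by rewrite abszE ler_norm.
  exact: rad_pow_unit_power.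
- exists (c ^+ `|k|); split=> // x kx.
  have : rad_pow (subring_set R) (radical_set R) (`|k|%N%:Z + k)
      (val (c ^+ `|k|) * x).
    rewrite (rad_powD RP Pc cd dc) valX; apply: mem_ideal_mul => //.
    exact: rad_pow_unit_power.
  apply: (rad_pow_anti RP Pc cd dc (l := 0)).
  by rewrite abszE -lerBlDr sub0r -normrN ler_norm.
Qed.

Theorem proposition5p1 (A : nzRingType) (R : subringClosed A)
    (hA : simple_artinian A)
    (hR : dubrovin_valuation_ring R)
    (hN : noetherian (subring_type R)) :
  exists add : set A -> set A -> set A,
    [/\ totally_ordered_group (value_set R) add (radical_set R) subset,
        arithmetical_pseudo_valuation R (value_set R) add (radical_set R)
          subset (val_of R) &
        ordered_isomorphic_to_subgroup_of_int (value_set R) add subset].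
Proof.
have RP := dubrovin_valuation_pair hR hN.
have valR := val_of_subring RP.
have [[c [creg Pc]]|noreg] :=
  pselect (exists c : subring_type R, regular_element c /\ radical_set R (val c)).
- have [d [cd dc]] := regular_element_val_invertible RP hA.2.1 creg.
  have fracE I := fractional_ideal_rad_pow I RP creg Pc cd dc.
  pose X := rad_pow (subring_set R) (radical_set R).
  have X_sub k l := rad_pow_subset RP Pc cd dc k l.
  have XD k l := esym (rad_powD RP Pc cd dc k l).
  (* Powers decrease with the exponent and [k] enters [1 - k] with a minus sign, so values increase
     with [k]. *)
  have valE k : val_of R (X k) = X (1 - k) := rad_pow_colon RP Pc cd dc k.
  have val_sub k l : val_of R (X k) `<=` val_of R (X l) <-> k <= l.
    by rewrite !valE X_sub lerD2l lerN2.
  exists (value_add R (GRing.ZmodClosed.clone int (dvdz 1) _) X).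
  by split; [apply: value_group | apply: value_pseudo_valuation
    | apply: value_group_int].
(* Without a regular element in the radical, the exponents form the zero subgroup, encoded as the
   multiples of [0], and the family of ideals is constant. *)
- have fracR : fractional_ideal R (subring_set R).
    split; first by apply/sub_bimoduleE; exact: vp_sub RP.
      by exists 1; split; [split; [exact: lreg1 | exact: rreg1] | exact: valP].
    exists 1; split; first by split; [exact: lreg1 | exact: rreg1].
    by move=> x; rewrite rmorph1 mul1r.
  have zeroE k : k \in dvdz 0 -> k = 0 by move=> Hk; apply/eqP; rewrite -dvd0z.
  have fracE I : fractional_ideal R I <->
      exists2 k, k \in GRing.ZmodClosed.clone int (dvdz 0) _ & I = subring_set R.
    split=> [fI|[_ _ ->] //]; exists 0 => //.
    apply: fractional_ideal_trivial fI => // a areg Pa.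
    by apply: noreg; exists a.
  exists (value_add R (GRing.ZmodClosed.clone int (dvdz 0) _)
    (fun=> subring_set R)).
  have subE (S : set A) k l : k \in dvdz 0 -> l \in dvdz 0 ->
    S `<=` S <-> k <= l by move=> /zeroE -> /zeroE ->; split=> // _ x.
  have RR : ideal_mul (subring_set R) (subring_set R) = subring_set R.
    by apply: (ideal_mul1l (vp_one RP)); exact: (vp_sub RP).1.
  split; [apply: value_group | apply: value_pseudo_valuation
    | apply: value_group_int] => // k l Hk Hl; apply: subE => //.
Qed.
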